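(* Assume: (A1) for every $\theta\in\Theta$ there exists a probability distribution $\pi_\theta$ on $(\mathsf{X},\mathcal{X})$ such that $\pi_\theta P_\theta=\pi_\theta$; (A2)(a) for every $\varepsilon>0$ there exists a nondecreasing sequence $\{r_\varepsilon(n), n\ge 0\}$ in $\mathbb{N}\setminus\{0\}$ such that $\limsup_{n\to\infty} r_\varepsilon(n)/n=0$ and $$\limsup_{n\to\infty}\mathbb{E}\Big[\big\|P_{\theta_{n-r_\varepsilon(n)}}^{r_\varepsilon(n)}(X_{n-r_\varepsilon(n)},\cdot)-\pi_{\theta_{n-r_\varepsilon(n)}}\big\|_{\mathrm{TV}}\Big]\le\varepsilon;$$ (A2)(b) for every $\varepsilon>0$ (and with the same sequence $r_\varepsilon$), $$\lim_{n\to\infty}\sum_{j=0}^{r_\varepsilon(n)-1}\mathbb{E}\big[D(\theta_{n-r_\varepsilon(n)+j},\theta_{n-r_\varepsilon(n)})\big]=0 .$$ Let $f:\mathsf{X}\to\mathbb{R}$ be a bounded measurable function such that $\lim_{n\to\infty}\pi_{\theta_n}(f)=\alpha$ $\mathbb{P}$-almost surely for some constant $\alpha$. Then $$\lim_{n\to\infty}\mathbb{E}[f(X_n)]=\alpha .$$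
   Context: $(\Theta,\mathcal{T})$ is a measurable space, $(\mathsf{X},\mathcal{X})$ is a general state space, and $\{P_\theta,\theta\in\Theta\}$ is a collection of Markov transition kernels on $(\mathsf{X},\mathcal{X})$. $\{(X_n,\theta_n), n\ge 0\}$ is an $\mathsf{X}\times\Theta$-valued process on a filtered probability space $(\Omega,\mathcal{A},\{\mathcal{F}_n,n\ge0\},\mathbb{P})$, $(X_n,\theta_n)$ is $\mathcal{F}_n$-adapted, and for every bounded measurable $f$, $\mathbb{E}[f(X_{n+1})\mid\mathcal{F}_n]=P_{\theta_n}f(X_n)$. Notation: $Pf(x)=\int P(x,dy)f(y)$, $\mu P(A)=\int\mu(dx)P(x,A)$, $P^n$ is the $n$-th iterate of $P$, $\mu(f)=\int f\,d\mu$. For probability measures $\mu_1,\mu_2$, $\|\mu_1-\mu_2\|_{\mathrm{TV}}=\sup\{|\mu_1(f)-\mu_2(f)| : \|f\|_\infty\le 1\}$. For $\theta,\theta'\in\Theta$, $D(\theta,\theta')=\sup_{x\in\mathsf{X}}\|P_\theta(x,\cdot)-P_{\theta'}(x,\cdot)\|_{\mathrm{TV}}$. Quantities indexed by $n-r_\varepsilon(n)$ are considered for $n$ large enough that $n\ge r_\varepsilon(n)$.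
   Formalization: The formal theorem additionally assumes that $(\theta,x)\mapsto P_\theta(x,A)$ is jointly measurable for every measurable $A$; without this convention the statement fails, e.g. for a trivial $\sigma$-algebra on $\Theta$. *)

(* Defs.v *)
From HB Require Import structures.
From mathcomp Require Import all_boot all_order all_algebra.
From mathcomp Require Import all_classical all_reals all_analysis.
From mathcomp Require Import measurable_realfun.

Set Implicit Arguments.
Unset Strict Implicit.
Unset Printing Implicit Defensive.

Import Order.TTheory GRing.Theory Num.Theory.
Import numFieldNormedType.Exports.

Local Open Scope classical_set_scope.
Local Open Scope ring_scope.
Local Open Scope ereal_scope.

Section probability_kcomp_noparam.
Context d0 d1 d2 (T0 : measurableType d0) (T1 : measurableType d1)
  (T2 : measurableType d2) (R : realType)
  (k1 : R.-pker T0 ~> T1) (k2 : R.-pker T1 ~> T2).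

Let prob_mkcomp_noparam x : mkcomp_noparam k1 k2 x [set: T2] = 1.
Proof.
rewrite /mkcomp_noparam/= /kcomp_noparam.
under eq_integral do rewrite prob_kernel.
by rewrite integral_cst// mul1e; exact: prob_kernel.
Qed.

HB.instance Definition _ := isProbabilityKernel.Build
  _ _ _ _ R (mkcomp_noparam k1 k2) prob_mkcomp_noparam.

End probability_kcomp_noparam.

Section markov_kernels.
Context d (X : measurableType d) (R : realType).

(* P^0(x, .) is the Dirac mass at x and P^(n+1)(x, A) = \int P(x, dy) P^n(y, A). *)
Fixpoint kernel_iter (P : R.-pker X ~> X) (n : nat) : R.-pker X ~> X :=
  if n is m.+1 then mkcomp_noparam P (kernel_iter P m)
  else kdirac (@measurable_id _ X setT).

(* The test functions range over |f| <= 1, so this is twice the supremum of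
   |mu1 A - mu2 A| over measurable sets A. *)
Definition tv_dist (mu1 mu2 : {measure set X -> \bar R}) : \bar R :=
  ereal_sup [set `|\int[mu1]_x (f x)%:E - \int[mu2]_x (f x)%:E| |
    f in [set f : X -> R |
      measurable_fun [set: X] f /\ forall x, (`|f x| <= 1)%R]].

Definition kernel_dist (P Q : R.-pker X ~> X) : \bar R :=
  ereal_sup [set tv_dist (P x) (Q x) | x in [set: X]].

End markov_kernels.

Section conditional_expectation.
Context d (Omega : measurableType d) (R : realType).

Definition is_filtration (F : nat -> set (set Omega)) : Prop :=
  [/\ forall n, sigma_algebra [set: Omega] (F n),
      forall n, F n `<=` measurable &
      forall m n, (m <= n)%N -> F m `<=` F n].

(* Y is a version of E[Z | G], for Z integrable. *)
Definition is_cond_expectation (Pr : probability Omega R)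
    (G : set (set Omega)) (Z Y : Omega -> \bar R) : Prop :=
  [/\ measurable_fun [set: g_sigma_algebraType G]
        (Y : g_sigma_algebraType G -> \bar R),
      Pr.-integrable [set: Omega] Y &
      forall A, G A -> \int[Pr]_(w in A) Y w = \int[Pr]_(w in A) Z w].

End conditional_expectation.

Section containment_diminishing_adaptation.
Context dX dT dO (X : measurableType dX) (Theta : measurableType dT)
  (Omega : measurableType dO) (R : realType).
Variables (Pr : probability Omega R) (P : Theta -> R.-pker X ~> X)
  (pi : Theta -> probability X R)
  (Xn : nat -> Omega -> X) (theta : nat -> Omega -> Theta).

Definition tv_to_target (m k : nat) (w : Omega) : \bar R :=
  tv_dist (kernel_iter (P (theta m w)) k (Xn m w)) (pi (theta m w)).

(* Truncation in [n - r n] only concerns finitely many n, as r n / n -> 0.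
   The expectation is that of a random variable: the measurability clause is
   needed because neither theta |-> pi theta nor a supremum over all test
   functions is measurable in general. *)
Definition containment (eps : R) (r : nat -> nat) : Prop :=
  (forall n, (r n <= n)%N ->
    measurable_fun [set: Omega] (tv_to_target (n - r n) (r n))) /\
  limn_esup (fun n => \int[Pr]_w tv_to_target (n - r n) (r n) w) <= eps%:E.

(* Unlike above, measurability of the integrand is not needed: the integral of
   a nonnegative function is the supremum of the integrals of the measurable
   simple functions below it, that is, the lower expectation in general. *)
Definition diminishing_adaptation (r : nat -> nat) : Prop :=
  (fun n => \sum_(0 <= j < r n) \int[Pr]_w
     kernel_dist (P (theta (n - r n + j)%N w)) (P (theta (n - r n)%N w)))
  @ \oo --> 0.

End containment_diminishing_adaptation.

(* Main.v *)
Require Import Defs.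
From HB Require Import structures.
From mathcomp Require Import all_boot all_order all_algebra.
From mathcomp Require Import all_classical all_reals all_analysis.
From mathcomp Require Import measurable_realfun.
From mathcomp Require Import ring lra zify.

Set Implicit Arguments.
Unset Strict Implicit.
Unset Printing Implicit Defensive.

Import Order.TTheory GRing.Theory Num.Theory.
Import numFieldNormedType.Exports.

Local Open Scope classical_set_scope.
Local Open Scope ring_scope.
Local Open Scope ereal_scope.

(** Write [m = n - r n]. Starting from time [m], compare the true process with
    the one that keeps the parameter [theta_m] fixed during [r n] steps: with
    [G] the mean of [f] after [r n] steps of the kernel [P_{theta_m}] started
    at [X_m],
    [[
      E f(X_n) - alpha = (E f(X_n) - E G) + (E G - alpha).
    ]]
    The first bracket telescopes. Replacing the true transition from time
    [m + j] by the frozen one changes the mean by at most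
    [E D(theta_{m+j}, theta_m)], because what remains of the frozen dynamics is
    a test function with values between 0 and 1 ([frozen_step], [frozen_dynamics]).
    This needs the Markov property for functions of the pair
    [(theta_m, X_{n+1})], and not only of [X_{n+1}]; it extends from rectangles
    by uniqueness of measures ([integral_disintegration], [markov_frozen]).

    For the second bracket one would like to insert [pi_{theta_m}(f)], which is
    within the total variation distance [T] of [G] and tends to [alpha] almost
    surely. But [theta |-> pi_theta] is an arbitrary family, so this function
    need not be measurable and has no expectation to speak of. The measurable
    functions [G] and [T] enclose it: the excess [max (|G - alpha| - T) 0] is
    measurable, bounded, and at most [|pi_{theta_m}(f) - alpha|], so its mean
    tends to 0 by dominated convergence ([cvg_integral_excess]), while
    [|G - alpha|] is at most [T] plus the excess ([mean_target_dist]).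
    Containment bounds the mean of [T].

    The argument is run for [f] with values between 0 and 1; an affine rescaling
    gives the general bounded case. *)

(** * Integrals *)

Section lower_integral.
Context d (T : measurableType d) (R : realType) (mu : {measure set T -> \bar R}).
Import HBNNSimple.

(** The integral of a nonnegative function is a supremum over the simple
    functions below it, so monotonicity needs no measurability. *)
Lemma ge0_le_lower_integral (h D : T -> \bar R) :
  (forall x, 0 <= h x) -> (forall x, h x <= D x) ->
  \int[mu]_x h x <= \int[mu]_x D x.
Proof.
move=> h0 hD; have D0 x : 0 <= D x by exact: le_trans (hD x).
rewrite !ge0_integralTE//; apply: ereal_sup_le => _ [g /= gh <-].
by exists g => //= x; exact: le_trans (hD x).
Qed.

End lower_integral.

Section unit_interval_valued.
Context d (T : measurableType d) (R : realType) (mu : {measure set T -> \bar R}).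
Variable f : T -> R.
Hypothesis mu1 : mu [set: T] = 1.
Hypotheses (mf : measurable_fun [set: T] f) (f01 : forall x, (0 <= f x <= 1)%R).

Lemma unit_integrable : mu.-integrable [set: T] (EFin \o f).
Proof.
apply: measurable_bounded_integrable => //.
  by rewrite mu1 ltry.
exists 1%R; split => // M M1 x _ /=; have /andP[f0 f1] := f01 x.
by rewrite ger0_norm// (le_trans f1)// ltW.
Qed.

Lemma unit_integral : 0 <= \int[mu]_x (f x)%:E <= 1.
Proof.
apply/andP; split.
  by apply: integral_ge0 => x _; rewrite lee_fin; case/andP: (f01 x).
rewrite -mu1 -[leRHS]mul1e -integral_cst//.
apply: ge0_le_integral => //.
- by move=> x _; rewrite lee_fin; case/andP: (f01 x).
- exact/measurable_EFinP.
- by move=> x _; rewrite lee_fin; case/andP: (f01 x).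
Qed.

Lemma unit_integral_fin_num : \int[mu]_x (f x)%:E \is a fin_num.
Proof. exact: integrable_fin_num unit_integrable. Qed.

End unit_interval_valued.

Lemma abse_unit_integralB d (T : measurableType d) (R : realType)
    (mu : {measure set T -> \bar R}) (f g : T -> R) : mu [set: T] = 1 ->
  measurable_fun [set: T] f -> (forall x, (0 <= f x <= 1)%R) ->
  measurable_fun [set: T] g -> (forall x, (0 <= g x <= 1)%R) ->
  `|\int[mu]_x (f x)%:E - \int[mu]_x (g x)%:E| <= \int[mu]_x `|f x - g x|%:E.
Proof.
move=> mu1 mf f01 mg g01; rewrite -integralB_EFin//; [|exact: unit_integrable..].
apply: le_abse_integral => //.
by apply/measurable_EFinP; exact: measurable_funB.
Qed.

(** * Kernels *)

Section family_kernel.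
Context d d' (S : measurableType d) (T : measurableType d') (R : realType).
Variable K : S -> {measure set T -> \bar R}.

(** The proofs are arguments so that the kernel instances below can be inferred
    from the term. *)
Definition family_kernel of (forall U, measurable U ->
  measurable_fun [set: S] (K ^~ U)) & (forall s, K s [set: T] = 1) := K.

Hypothesis mK : forall U, measurable U -> measurable_fun [set: S] (K ^~ U).
Hypothesis K1 : forall s, K s [set: T] = 1.

HB.instance Definition _ := isKernel.Build _ _ _ _ _ (family_kernel mK K1) mK.

HB.instance Definition _ := Kernel_isProbability.Build _ _ _ _ _
  (family_kernel mK K1) K1.

End family_kernel.

Lemma integral_mkcomp_noparam d0 d1 d2 (T0 : measurableType d0)
    (T1 : measurableType d1) (T2 : measurableType d2) (R : realType)
    (k1 : R.-pker T0 ~> T1) (k2 : R.-pker T1 ~> T2) x (g : T2 -> \bar R) :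
  (forall z, 0 <= g z) -> measurable_fun [set: T2] g ->
  \int[mkcomp_noparam k1 k2 x]_z g z = \int[k1 x]_y \int[k2 y]_z g z.
Proof.
move=> g0 mg.
have mk2 U : measurable U ->
    measurable_fun [set: T0 * T1] (fun p : T0 * T1 => k2 p.2 U).
  move=> mU.
  exact: (measurableT_comp (measurable_kernel k2 _ mU) measurable_snd).
have k21 (p : T0 * T1) : k2 p.2 [set: T2] = 1 by exact: prob_kernel.
(* [k2] is seen as a kernel from [T0 * T1] that ignores its first argument. *)
exact: (integral_kcomp k1 (family_kernel mk2 k21)).
Qed.

(** Both sides are integrals of [g] over [Theta * X], against the law of
    [(tau, Y)] and against the mixture over [w] of the images of [L w] under
    [y |-> (tau w, y)]; the hypothesis says that these probability measures
    agree on the pi-system of rectangles. *)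
Lemma integral_disintegration dO dT dX (Omega : measurableType dO)
    (Theta : measurableType dT) (X : measurableType dX) (R : realType)
    (Pr : probability Omega R) (L : R.-pker Omega ~> X)
    (tau : Omega -> Theta) (Y : Omega -> X) (g : Theta * X -> \bar R) :
  measurable_fun [set: Omega] tau -> measurable_fun [set: Omega] Y ->
  (forall A B, measurable A -> measurable B ->
    Pr (tau @^-1` A `&` Y @^-1` B) = \int[Pr]_(w in tau @^-1` A) L w B) ->
  (forall p, 0 <= g p) -> measurable_fun [set: Theta * X] g ->
  \int[Pr]_w g (tau w, Y w) = \int[Pr]_w \int[L w]_y g (tau w, y).
Proof.
move=> mtau mY rect g0 mg.
have mpair w : measurable_fun [set: X] (fun y => (tau w, y)).
  exact: measurable_fun_pair.
have mtY : measurable_fun [set: Omega] (fun w => (tau w, Y w)).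
  exact: measurable_fun_pair.
pose law w : {measure set (Theta * X) -> \bar R} :=
  pushforward (L w) (fun y => (tau w, y)).
pose N := law mpair.
have NE w C : measurable C ->
    N w C = \int[L w]_y (\1_C (tau w, y))%:E.
  move=> mC; rewrite -[RHS]/(\int[L w]_y (\1_((fun y => (tau w, y)) @^-1` C) y)%:E).
  rewrite integral_indic ?setIT// -[X in measurable X]setTI; exact: (mpair w).
have mN C : measurable C -> measurable_fun [set: Omega] (N ^~ C).
  move=> mC; under eq_fun do rewrite NE//.
  apply: (measurable_fun_integral_sfinite_kernel
    (fun p : Omega * X => (\1_C (tau p.1, p.2))%:E) L).
    by move=> p; rewrite lee_fin.
  apply/measurable_EFinP; apply: measurableT_comp => //.
  by apply: measurable_fun_pair => //; exact: measurableT_comp.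
have N1 w : N w [set: Theta * X] = 1 by exact: prob_kernel.
have mPr U : measurable U -> measurable_fun [set: unit] (fun _ : unit => Pr U).
  by [].
have Pr1 (s : unit) : Pr [set: Omega] = 1 by exact: probability_setT.
(* The mixture is a composition of kernels issued from a one-point space. *)
pose Q := mkcomp_noparam (family_kernel mPr Pr1) (family_kernel mN N1) tt.
transitivity (\int[pushforward Pr (fun w => (tau w, Y w))]_p g p).
  by rewrite ge0_integral_pushforward.
transitivity (\int[Q]_p g p).
  apply: eq_measure_integral => C mC _.
  pose G : set (set (Theta * X)) :=
    [set A `*` B | A in measurable & B in measurable].
  apply: (measure_unique G (fun=> setT)) => //.
  - by rewrite measurable_prod_measurableType.
  - move=> _ _ [A1 mA1 [B1 mB1 <-]] [A2 mA2 [B2 mB2 <-]].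
    rewrite -setXI; exists (A1 `&` A2); first exact: measurableI.
    by exists (B1 `&` B2) => //; exact: measurableI.
  - by move=> _; exists setT => //; exists setT => //; rewrite setXTT.
  - by rewrite bigcup_const//; exists 0%N.
  - move=> _ [A mA [B mB <-]].
    rewrite /Q/= /mkcomp_noparam/= /kcomp_noparam /=.
    rewrite -[LHS]/(Pr (tau @^-1` A `&` Y @^-1` B)) rect//.
    rewrite integral_mkcond; apply: eq_integral => w _.
    rewrite patchE/=; case: ifPn => [|]; rewrite ?inE ?notin_setE /= => tA.
      congr (L w _); apply/seteqP; split=> y //=; by [|case].
    rewrite /N /pushforward (_ : _ @^-1` _ = set0) ?measure0//.
    by apply/seteqP; split=> y //= [].
  - move=> _; rewrite /= /pushforward preimage_setT.
    by rewrite probability_setT ltry.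
rewrite /Q integral_mkcomp_noparam//.
by apply: eq_integral => w _; rewrite /= /family_kernel ge0_integral_pushforward.
Qed.

(** * Total variation *)

Section total_variation.
Context d (X : measurableType d) (R : realType).

Lemma le_tv_dist (mu1 mu2 : {measure set X -> \bar R}) (g : X -> R) :
  measurable_fun [set: X] g -> (forall x, (`|g x| <= 1)%R) ->
  `|\int[mu1]_x (g x)%:E - \int[mu2]_x (g x)%:E| <= tv_dist mu1 mu2.
Proof. by move=> mg g1; apply: ereal_sup_ubound; exists g. Qed.

Lemma tv_dist_ge0 (mu1 mu2 : {measure set X -> \bar R}) :
  0 <= tv_dist mu1 mu2.
Proof.
rewrite (le_trans _ (@le_tv_dist mu1 mu2 (cst 0%R) _ _))// => x.
by rewrite normr0.
Qed.

Lemma tv_dist_le_kernel_dist (P Q : R.-pker X ~> X) x :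
  tv_dist (P x) (Q x) <= kernel_dist P Q.
Proof. by apply: ereal_sup_ubound; exists x. Qed.

End total_variation.

(** * Iterated kernels *)

Section iterated_kernel.
Context dX dT (X : measurableType dX) (Theta : measurableType dT)
  (R : realType).
Variables (P : Theta -> R.-pker X ~> X) (f : X -> R).
Hypothesis hP : forall A : set X, measurable A ->
  measurable_fun [set: Theta * X] (fun p : Theta * X => P p.1 p.2 A).
Hypotheses (mf : measurable_fun [set: X] f) (f01 : forall x, (0 <= f x <= 1)%R).

(** [P_theta^k f x], on pairs [(theta, x)] because it is evaluated at the random
    parameter [theta_m] and must be jointly measurable. *)
Definition iter_mean (k : nat) (p : Theta * X) : R :=
  fine (\int[kernel_iter (P p.1) k p.2]_y (f y)%:E).

Lemma iter_meanE k p :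
  (iter_mean k p)%:E = \int[kernel_iter (P p.1) k p.2]_y (f y)%:E.
Proof. by rewrite fineK// unit_integral_fin_num//; exact: prob_kernel. Qed.

Lemma iter_mean_unit k p : (0 <= iter_mean k p <= 1)%R.
Proof.
by rewrite -!lee_fin iter_meanE unit_integral//; exact: prob_kernel.
Qed.

Lemma iter_mean0 p : iter_mean 0 p = f p.2.
Proof.
apply: EFin_inj; rewrite iter_meanE/= integral_dirac//; last first.
  exact/measurable_EFinP.
by rewrite diracT mul1e.
Qed.

Lemma iter_meanS k p :
  (iter_mean k.+1 p)%:E = \int[P p.1 p.2]_y (iter_mean k (p.1, y))%:E.
Proof.
rewrite iter_meanE/= integral_mkcomp_noparam//=; last 2 first.
- by move=> z; rewrite lee_fin; case/andP: (f01 z).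
- exact/measurable_EFinP.
by apply: eq_integral => y _; rewrite iter_meanE.
Qed.

Lemma measurable_iter_mean k : measurable_fun [set: Theta * X] (iter_mean k).
Proof.
elim: k => [|k IH].
  rewrite (_ : iter_mean 0 = f \o snd); first exact: measurableT_comp.
  by apply/funext => p; rewrite iter_mean0.
apply/measurable_EFinP; rewrite /comp; under eq_fun do rewrite iter_meanS.
have P1 (p : Theta * X) : P p.1 p.2 [set: X] = 1 by exact: prob_kernel.
apply: (measurable_fun_integral_sfinite_kernel
  (fun q : (Theta * X) * X => (iter_mean k (q.1.1, q.2))%:E)
  (family_kernel hP P1)).
  by move=> q; rewrite lee_fin; case/andP: (iter_mean_unit k (q.1.1, q.2)).
apply/measurable_EFinP; apply: (measurableT_comp IH).
apply: measurable_fun_pair => //.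
exact: (measurableT_comp measurable_fst measurable_fst).
Qed.

Lemma measurable_iter_mean_section k t :
  measurable_fun [set: X] (fun y => iter_mean k (t, y)).
Proof.
apply: (measurableT_comp (measurable_iter_mean k)).
exact: measurable_fun_pair.
Qed.

End iterated_kernel.

(** * The adaptive process *)

Section adaptive_process.
Context (R : realType) (dX dT dO : measure_display)
  (X : measurableType dX) (Theta : measurableType dT)
  (Omega : measurableType dO) (Pr : probability Omega R)
  (F : nat -> set (set Omega)) (P : Theta -> R.-pker X ~> X)
  (Xn : nat -> Omega -> X) (theta : nat -> Omega -> Theta).
Hypothesis hF : is_filtration F.
Hypothesis hP : forall A : set X, measurable A ->
  measurable_fun [set: Theta * X] (fun p : Theta * X => P p.1 p.2 A).
Hypothesis hadapted : forall n, measurable_fun [set: g_sigma_algebraType (F n)]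
  (fun w : g_sigma_algebraType (F n) => (Xn n w, theta n w)).
Hypothesis hmarkov :
  forall g : X -> R, measurable_fun [set: X] g -> bounded_fun g ->
  forall n, is_cond_expectation Pr (F n)
    (fun w => (g (Xn n.+1 w))%:E)
    (fun w => \int[P (theta n w) (Xn n w)]_y (g y)%:E).

Lemma adapted_preimage n C : measurable C ->
  F n ((fun w => (Xn n w, theta n w)) @^-1` C).
Proof.
move=> mC; have [sF _ _] := hF.
have := hadapted (n := n) measurableT mC.
by rewrite setTI /measurable/= sigma_algebra_id.
Qed.

Lemma adapted_measurable n :
  measurable_fun [set: Omega] (fun w => (Xn n w, theta n w)).
Proof.
move=> _ C mC; rewrite setTI; have [_ Fm _] := hF.
exact/Fm/adapted_preimage.
Qed.

Lemma measurable_Xn n : measurable_fun [set: Omega] (Xn n).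
Proof. exact: (measurableT_comp measurable_fst (adapted_measurable n)). Qed.

Lemma measurable_theta n : measurable_fun [set: Omega] (theta n).
Proof. exact: (measurableT_comp measurable_snd (adapted_measurable n)). Qed.

Lemma theta_preimage m n A : (m <= n)%N -> measurable A ->
  F n (theta m @^-1` A).
Proof.
move=> mn mA; have [_ _ Fmn] := hF; apply: (Fmn _ _ mn).
rewrite (_ : _ @^-1` _ = (fun w => (Xn m w, theta m w)) @^-1` (setT `*` A)).
  by apply: adapted_preimage; exact: measurableX.
by apply/seteqP; split => w //= [].
Qed.

Lemma measurable_transition n U : measurable U ->
  measurable_fun [set: Omega] (fun w => P (theta n w) (Xn n w) U).
Proof.
move=> mU; exact: (measurableT_comp (hP mU)
  (measurable_fun_pair (measurable_theta n) (measurable_Xn n))).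
Qed.

(** The conditional expectation given [F n] only yields the rectangles; a
    parameter known at time [m <= n] may be treated as a constant during the
    transition from [n] to [n.+1]. *)
Lemma markov_frozen m n (g : Theta * X -> \bar R) : (m <= n)%N ->
  (forall p, 0 <= g p) -> measurable_fun [set: Theta * X] g ->
  \int[Pr]_w g (theta m w, Xn n.+1 w) =
  \int[Pr]_w \int[P (theta n w) (Xn n w)]_y g (theta m w, y).
Proof.
move=> mn g0 mg.
have mL := @measurable_transition n.
have L1 w : P (theta n w) (Xn n w) [set: X] = 1 by exact: prob_kernel.
apply: (integral_disintegration (L := family_kernel mL L1)) => //.
- exact: measurable_theta.
- exact: measurable_Xn.
move=> A B mA mB.
have bB : bounded_fun (\1_B : X -> R).
  exists 1%R; split => // M M1 x _ /=; rewrite indicE.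
  by case: (_ \in _); rewrite ?normr1 ?normr0 ltW// (lt_trans _ M1).
have [_ _ /(_ _ (theta_preimage mn mA))] := hmarkov (measurable_indic mB) bB n.
under eq_integral do rewrite integral_indic// setIT.
rewrite /= /family_kernel => ->.
have mtA : measurable (theta m @^-1` A).
  by rewrite -[X in measurable X]setTI; exact: measurable_theta.
have mXB : measurable (Xn n.+1 @^-1` B).
  by rewrite -[X in measurable X]setTI; exact: measurable_Xn.
rewrite -[RHS]/(\int[Pr]_(w in _) (\1_(Xn n.+1 @^-1` B) w)%:E).
by rewrite integral_indic// setIC.
Qed.

Section frozen_dynamics.
Variable f : X -> R.
Hypotheses (mf : measurable_fun [set: X] f) (f01 : forall x, (0 <= f x <= 1)%R).

Let measurable_frozen k m n :
  measurable_fun [set: Omega] (fun w => iter_mean P f k (theta m w, Xn n w)).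
Proof.
exact: (measurableT_comp (measurable_iter_mean hP mf f01 k)
  (measurable_fun_pair (measurable_theta m) (measurable_Xn n))).
Qed.

(** Both means involve the same test function, the remaining [k] steps of the
    frozen kernel; they differ by whether the transition at time [n] follows
    [theta n] or [theta m]. *)
Lemma frozen_step m n k : (m <= n)%N ->
  `|\int[Pr]_w (iter_mean P f k (theta m w, Xn n.+1 w))%:E -
    \int[Pr]_w (iter_mean P f k.+1 (theta m w, Xn n w))%:E| <=
  \int[Pr]_w kernel_dist (P (theta n w)) (P (theta m w)).
Proof.
move=> mn.
(* The first mean, conditioned on the past of time [n]. *)
pose g w : R := fine (\int[P (theta n w) (Xn n w)]_y
  (iter_mean P f k (theta m w, y))%:E).
have mk t := measurable_iter_mean_section hP mf f01 k t.
have k01 t y := iter_mean_unit P mf f01 k (t, y).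
have gE w : (g w)%:E = \int[P (theta n w) (Xn n w)]_y
    (iter_mean P f k (theta m w, y))%:E.
  by rewrite fineK//; apply: unit_integral_fin_num => //; exact: prob_kernel.
have g01 w : (0 <= g w <= 1)%R.
  by rewrite -!lee_fin gE; apply: unit_integral => //; exact: prob_kernel.
have mg : measurable_fun [set: Omega] g.
  apply/measurable_EFinP; rewrite /comp; under eq_fun do rewrite gE.
  have mL := @measurable_transition n.
  have L1 w : P (theta n w) (Xn n w) [set: X] = 1 by exact: prob_kernel.
  apply: (measurable_fun_integral_sfinite_kernel
    (fun q : Omega * X => (iter_mean P f k (theta m q.1, q.2))%:E)
    (family_kernel mL L1)).
    by move=> q; rewrite lee_fin; case/andP: (k01 (theta m q.1) q.2).
  apply/measurable_EFinP.
  apply: (measurableT_comp (measurable_iter_mean hP mf f01 k)).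
  apply: measurable_fun_pair => //.
  exact: (measurableT_comp (measurable_theta m) measurable_fst).
rewrite (markov_frozen (g := fun p => (iter_mean P f k p)%:E) mn); last 2 first.
- by move=> p; rewrite lee_fin; case/andP: (iter_mean_unit P mf f01 k p).
- by apply/measurable_EFinP; exact: measurable_iter_mean.
under eq_integral do rewrite -gE.
apply: (le_trans (abse_unit_integralB _ mg g01 _ _)).
- exact: probability_setT.
- exact: measurable_frozen.
- by move=> w; exact: iter_mean_unit.
(* The integrand on the right need not be measurable, the one on the left is. *)
apply: ge0_le_lower_integral => w; first by rewrite lee_fin.
rewrite -abse_EFin EFinB (gE w).
rewrite (iter_meanS P mf f01 k (theta m w, Xn n w)) /fst /snd.
apply: le_trans (tv_dist_le_kernel_dist _ _ (Xn n w)).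
apply: (le_tv_dist _ _ (g := fun y => iter_mean P f k (theta m w, y))) => // y.
by have /andP[? ?] := k01 (theta m w) y; rewrite ger0_norm.
Qed.

Lemma frozen_dynamics m r :
  `|\int[Pr]_w (f (Xn (m + r)%N w))%:E -
    \int[Pr]_w (iter_mean P f r (theta m w, Xn m w))%:E| <=
  \sum_(0 <= j < r)
    \int[Pr]_w kernel_dist (P (theta (m + j)%N w)) (P (theta m w)).
Proof.
(* Follow the true process for [j] steps, then the frozen one for [r - j]. *)
pose E j := \int[Pr]_w (iter_mean P f (r - j) (theta m w, Xn (m + j)%N w))%:E.
have Efin j : E j \is a fin_num.
  apply: unit_integral_fin_num.
  - exact: probability_setT.
  - exact: measurable_frozen.
  - by move=> w; exact: iter_mean_unit.
have -> : \int[Pr]_w (f (Xn (m + r)%N w))%:E = E r.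
  by rewrite /E subnn; apply: eq_integral => w _; rewrite iter_mean0.
have -> : \int[Pr]_w (iter_mean P f r (theta m w, Xn m w))%:E = E 0%N.
  by rewrite /E subn0 addn0.
suff : forall j, (j <= r)%N -> `|E j - E 0%N| <= \sum_(0 <= i < j)
    \int[Pr]_w kernel_dist (P (theta (m + i)%N w)) (P (theta m w)) by exact.
elim => [_|j IH jr]; first by rewrite big_geq// subee// abse0.
rewrite big_nat_recr//= (_ : E j.+1 - E 0%N = (E j - E 0%N) + (E j.+1 - E j)).
  rewrite (le_trans (lee_abs_add _ _))// leeD ?IH ?(ltnW jr)// /E addnS.
  by rewrite -(subnSK jr) frozen_step ?leq_addr.
by rewrite -(fineK (Efin j)) -(fineK (Efin 0%N)) -(fineK (Efin j.+1)) -!EFinB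
  -EFinD; congr EFin; rewrite [RHS]addrC addrA subrK.
Qed.

End frozen_dynamics.
End adaptive_process.

(** * Limits of extended real sequences *)

Lemma limn_esup_lt_near (R : realType) (u : nat -> \bar R) (c : \bar R) :
  limn_esup u < c -> \forall n \near \oo, u n < c.
Proof.
move=> /ereal_inf_lt[_ [A Aoo <-] supA]; near=> n.
apply: le_lt_trans supA; apply: ereal_sup_ubound; exists n => //.
by near: n.
Unshelve. all: by end_near. Qed.

Lemma cvge_finP (R : realType) (u : nat -> \bar R) (l : R) :
  u @ \oo --> l%:E <->
  forall e : R, (0 < e)%R -> \forall n \near \oo, `|u n - l%:E| < e%:E.
Proof.
split=> [/fine_cvgP[ufin /cvgrPdist_lt ul] e e0|ul]; first near=> n.
  have un : u n \is a fin_num by near: n.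
  rewrite -(fineK un) -EFinB abse_EFin lte_fin distrC.
  by near: n; exact: ul.
have ufin n (e : R) : `|u n - l%:E| < e%:E -> u n \is a fin_num.
  by case: (u n).
apply/fine_cvgP; split.
  by apply: filterS (ul _ ltr01) => n; exact: ufin.
apply/cvgrPdist_lt => e e0; apply: filterS (ul _ e0) => n une /=.
by move: (une); rewrite -(fineK (ufin _ _ une)) -EFinB abse_EFin lte_fin distrC.
Unshelve. all: by end_near. Qed.

(** The factor 2 makes [n - r n] tend to infinity. *)
Lemma lag_near (R : realType) (r : nat -> nat) :
  limn_esup (fun n => ((r n)%:R / n%:R : R)%:E) = 0 ->
  \forall n \near \oo, (r n * 2 <= n)%N.
Proof.
move=> r0; have : \forall n \near \oo, ((r n)%:R / n%:R : R)%:E < (2^-1)%:E.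
  by apply: limn_esup_lt_near; rewrite r0 lte_fin invr_gt0.
move=> rn; near=> n; have n0 : (0 < n)%N by near: n; exact: nbhs_infty_gt.
have : ((r n)%:R / n%:R : R)%:E < (2^-1)%:E by near: n.
rewrite lte_fin ltr_pdivrMr ?ltr0n// mulrC ltr_pdivlMr// -natrM ltr_nat.
exact: ltnW.
Unshelve. all: by end_near. Qed.

(** * Reduction to values in the unit interval *)

Lemma affine_integral d (T : measurableType d) (R : realType)
    (mu : {measure set T -> \bar R}) (f : T -> R) (c b : R) :
  mu [set: T] = 1 -> measurable_fun [set: T] f -> bounded_fun f ->
  \int[mu]_x (c * f x + b)%:E = c%:E * (\int[mu]_x (f x)%:E) + b%:E.
Proof.
move=> mu1 mf bf.
have fin : mu [set: T] < +oo by rewrite mu1 ltry.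
have intf : mu.-integrable [set: T] (EFin \o f).
  exact: measurable_bounded_integrable.
under eq_integral do rewrite EFinD.
rewrite integralD_EFin//; last 2 first.
- exact: (integrableZl measurableT c intf).
- apply: measurable_bounded_integrable => //.
  by exists `|b|%R; split => // M bM x _ /=; exact: ltW.
by rewrite -(integralZl measurableT intf) integral_cst// mu1 mule1.
Qed.

Lemma unit_rescaling (T : Type) (R : realType) (f : T -> R) :
  bounded_fun f ->
  exists c b : R, c != 0%R /\ forall x, (0 <= c * f x + b <= 1)%R.
Proof.
move=> [M [_ /(_ (`|M| + 1)%R)]] fM.
set K := (`|M| + 1)%R in fM.
have K0 : (0 < K)%R by rewrite /K ltr_wpDl.
exists (2 * K)^-1%R, (2^-1)%R; split.
  by rewrite invr_neq0// mulf_neq0 ?gt_eqF.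
move=> x; have : (`|f x| <= K)%R.
  by apply: fM => //; rewrite (le_lt_trans (ler_norm _))// ltrDl.
have -> : ((2 * K)^-1 * f x + 2^-1 = (f x + K) / (2 * K))%R.
  by field; rewrite gt_eqF.
rewrite ler_norml => /andP[fK1 fK2].
rewrite divr_ge0 ?mulr_ge0 ?ler_pdivrMr ?mulr_gt0 ?(ltW K0)//=; lra.
Qed.

(** * Convergence of the means *)

Section convergence.
Context (R : realType) (dX dT dO : measure_display)
  (X : measurableType dX) (Theta : measurableType dT)
  (Omega : measurableType dO) (Pr : probability Omega R)
  (F : nat -> set (set Omega)) (P : Theta -> R.-pker X ~> X)
  (Xn : nat -> Omega -> X) (theta : nat -> Omega -> Theta)
  (pi : Theta -> probability X R).
Hypothesis hF : is_filtration F.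
Hypothesis hP : forall A : set X, measurable A ->
  measurable_fun [set: Theta * X] (fun p : Theta * X => P p.1 p.2 A).
Hypothesis hadapted : forall n, measurable_fun [set: g_sigma_algebraType (F n)]
  (fun w : g_sigma_algebraType (F n) => (Xn n w, theta n w)).
Hypothesis hmarkov :
  forall g : X -> R, measurable_fun [set: X] g -> bounded_fun g ->
  forall n, is_cond_expectation Pr (F n)
    (fun w => (g (Xn n.+1 w))%:E)
    (fun w => \int[P (theta n w) (Xn n w)]_y (g y)%:E).
Variables (f : X -> R) (alpha : R).
Hypotheses (mf : measurable_fun [set: X] f) (f01 : forall x, (0 <= f x <= 1)%R).
Hypothesis hlim : {ae Pr, forall w,
  (fun n => \int[pi (theta n w)]_x (f x)%:E) @ \oo --> alpha%:E}.

Let G r m w := iter_mean P f r (theta m w, Xn m w).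

Let mG r m : measurable_fun [set: Omega] (G r m).
Proof.
exact: (measurableT_comp (measurable_iter_mean hP mf f01 r)
  (measurable_fun_pair (measurable_theta hF hadapted m)
    (measurable_Xn hF hadapted m))).
Qed.

Let G01 r m w : (0 <= G r m w <= 1)%R.
Proof. exact: iter_mean_unit. Qed.

(** Truncation keeps the distance real-valued, and loses nothing when comparing
    means of functions with values between 0 and 1. *)
Let tv1 r m w : R := fine (Order.min (tv_to_target P pi Xn theta m r w) 1).

Let tv1E r m w :
  (tv1 r m w)%:E = Order.min (tv_to_target P pi Xn theta m r w) 1.
Proof.
rewrite fineK// ge0_fin_numE; first by rewrite gt_min ltry orbT.
by rewrite le_min tv_dist_ge0 lee01.
Qed.

Let tv1_unit r m w : (0 <= tv1 r m w <= 1)%R.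
Proof. by rewrite -!lee_fin tv1E le_min tv_dist_ge0 lee01 ge_min lexx orbT. Qed.

Let pif w m : \int[pi (theta m w)]_x (f x)%:E \is a fin_num.
Proof. by apply: unit_integral_fin_num => //; exact: probability_setT. Qed.

Let G_target r m w :
  (`|G r m w - fine (\int[pi (theta m w)]_x (f x)%:E)| <= tv1 r m w)%R.
Proof.
rewrite -lee_fin tv1E le_min; apply/andP; split.
  rewrite -abse_EFin EFinB (fineK (pif w m)) /G.
  rewrite (iter_meanE P mf f01 r (theta m w, Xn m w)).
  apply: le_tv_dist => // x.
  by have /andP[? ?] := f01 x; rewrite ger0_norm.
rewrite lee_fin; have /andP[? ?] := G01 r m w.
have := unit_integral (probability_setT (pi (theta m w))) mf f01.
rewrite -(fineK (pif w m)) !lee_fin => /andP[? ?].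
rewrite ler_norml; lra.
Qed.

(** A measurable lower bound for the distance from [pi_{theta m}(f)] to
    [alpha]. *)
Let excess r m w : R := Num.max (`|G r m w - alpha| - tv1 r m w)%R 0%R.

Let excess_ge0 r m w : (0 <= excess r m w)%R.
Proof. by rewrite /excess le_max lexx orbT. Qed.

Let excess_le r m w :
  (`|excess r m w| <= `|fine (\int[pi (theta m w)]_x (f x)%:E) - alpha|)%R.
Proof.
rewrite (ger0_norm (excess_ge0 r m w)) /excess ge_max normr_ge0 andbT.
have := G_target r m w.
have := ler_distD (fine (\int[pi (theta m w)]_x (f x)%:E)) (G r m w) alpha.
lra.
Qed.

Let excess_bound r m w : (`|excess r m w| <= 1 + `|alpha|)%R.
Proof.
rewrite (ger0_norm (excess_ge0 r m w)) /excess ge_max addr_ge0// andbT.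
have /andP[g0 g1] := G01 r m w; have /andP[t0 _] := tv1_unit r m w.
have := ler_normB (G r m w) alpha; rewrite (ger0_norm g0); lra.
Qed.

(** The a.s. limit of [pi_{theta_n}(f)] enters here only as a pointwise bound,
    so that dominated convergence is applied to measurable functions. *)
Lemma cvg_integral_excess (r m : nat -> nat) :
  m @ \oo --> \oo ->
  (forall n, measurable_fun [set: Omega]
    (tv_to_target P pi Xn theta (m n) (r n))) ->
  (fun n => \int[Pr]_w (excess (r n) (m n) w)%:E) @ \oo --> 0.
Proof.
move=> moo mT.
have mtv1 n : measurable_fun [set: Omega] (tv1 (r n) (m n)).
  by apply: measurableT_comp => //; exact: measurable_mine.
have mH n : measurable_fun [set: Omega] (fun w => (excess (r n) (m n) w)%:E).
  apply/measurable_EFinP; apply: measurable_maxr => //.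
  apply: measurable_funB => //; apply: measurableT_comp => //.
  exact: measurable_funB.
have [] := @dominated_convergence _ _ _ Pr _ measurableT
  (fun n w => (excess (r n) (m n) w)%:E) (cst 0) (cst (1 + `|alpha|)%:E) mH.
- exact: measurable_cst.
- apply: filterS hlim => w /fine_cvgP[_ piw] _.
  apply: cvg_EFin; first exact: nearW.
  rewrite /comp /=; apply/norm_cvg0P.
  apply: (@squeeze_cvgr _ _ _ _ (cst 0%R) (fun n =>
    `|fine (\int[pi (theta (m n) w)]_x (f x)%:E) - alpha|)%R).
  + by apply: nearW => n; rewrite normr_ge0 excess_le.
  + exact: cvg_cst.
  + apply/norm_cvg0P; apply/subr_cvg0.
    exact: (cvg_comp _ _ moo piw).
- exact: finite_measure_integrable_cst.
- by apply: aeW => w n _ /=; rewrite lee_fin excess_bound.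
by move=> _ _; rewrite integral0.
Qed.

(** Pointwise, [|G - alpha|] is at most the excess plus the distance to the
    target. *)
Lemma mean_target_dist r m :
  measurable_fun [set: Omega] (tv_to_target P pi Xn theta m r) ->
  `|\int[Pr]_w (G r m w)%:E - alpha%:E| <=
  \int[Pr]_w (excess r m w)%:E + \int[Pr]_w tv_to_target P pi Xn theta m r w.
Proof.
move=> mT.
have mtv1 : measurable_fun [set: Omega] (tv1 r m).
  by apply: measurableT_comp => //; exact: measurable_mine.
have mGa : measurable_fun [set: Omega] (fun w => G r m w - alpha)%R.
  exact: measurable_funB.
have mH : measurable_fun [set: Omega] (excess r m).
  apply: measurable_maxr => //; apply: measurable_funB => //.
  exact: measurableT_comp.
have -> : \int[Pr]_w (G r m w)%:E - alpha%:E =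
    \int[Pr]_w (G r m w - alpha)%:E.
  rewrite -[X in _ - X]mule1 -(probability_setT Pr) -integral_cst//.
  rewrite -integralB_EFin//.
    by apply: unit_integrable => //; exact: probability_setT.
  exact: finite_measure_integrable_cst.
rewrite (le_trans (le_abse_integral _ _ _))//; first exact/measurable_EFinP.
have le2 : \int[Pr]_w (tv1 r m w)%:E <=
    \int[Pr]_w tv_to_target P pi Xn theta m r w.
  apply: ge0_le_lower_integral => w.
    by rewrite lee_fin; case/andP: (tv1_unit r m w).
  by rewrite tv1E ge_min lexx.
rewrite (le_trans _ (leeD (lexx _) le2))//.
rewrite -ge0_integralD//; last 4 first.
- by move=> w _; rewrite lee_fin.
- exact/measurable_EFinP.
- by move=> w _; rewrite lee_fin; case/andP: (tv1_unit r m w).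
- exact/measurable_EFinP.
apply: ge0_le_lower_integral => w //.
by rewrite abse_EFin -EFinD lee_fin -lerBlDr /excess le_max lexx.
Qed.

Lemma unit_mean_cvg :
  (forall eps : R, (0 < eps)%R -> exists r : nat -> nat,
    [/\ limn_esup (fun n => ((r n)%:R / n%:R : R)%:E) = 0,
        containment Pr P pi Xn theta eps r &
        diminishing_adaptation Pr P theta r]) ->
  (fun n => \int[Pr]_w (f (Xn n w))%:E) @ \oo --> alpha%:E.
Proof.
move=> A2; apply/cvge_finP => e e0.
have e8 : (0 < e / 8)%R by rewrite divr_gt0.
have e4 : (0 < e / 4)%R by rewrite divr_gt0.
have [r [r0 [mT cont] dim]] := A2 _ e8.
(* The measurability clause of containment holds where [r n <= n] only, so the
   sequences are shifted by [N]. *)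
have [N _ rN] := lag_near r0.
pose m n := (n - r n)%N.
have moo : (fun n => m (n + N)%N) @ \oo --> \oo.
  apply/cvgnyPge => K; near=> n.
  have := rN (n + N)%N (leq_addl _ _).
  have : (2 * K <= n)%N by near: n; exact: nbhs_infty_ge.
  rewrite /m /=; lia.
have Hcvg : (fun n => \int[Pr]_w (excess (r n) (m n) w)%:E) @ \oo --> 0.
  rewrite -(cvg_shiftn N).
  apply: (@cvg_integral_excess (fun n => r (n + N)%N)
    (fun n => m (n + N)%N)) => // n.
  by apply: mT; have := rN (n + N)%N (leq_addl _ _); lia.
have Hnear : \forall n \near \oo,
    `|\int[Pr]_w (excess (r n) (m n) w)%:E - 0| < (e / 4)%:E.
  exact: (cvge_finP _ _).1 Hcvg _ e4.
have Dnear := (cvge_finP _ _).1 dim _ e4.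
have Tnear : \forall n \near \oo,
    \int[Pr]_w tv_to_target P pi Xn theta (m n) (r n) w < (e / 4)%:E.
  by apply: limn_esup_lt_near; rewrite (le_lt_trans cont)// lte_fin; lra.
near=> n.
have rn : (r n <= n)%N.
  have /rN : (N <= n)%N by near: n; exact: nbhs_infty_ge.
  by rewrite /=; lia.
have Gfin : \int[Pr]_w (G (r n) (m n) w)%:E \is a fin_num.
  by apply: unit_integral_fin_num => //; exact: probability_setT.
have := frozen_dynamics hF hP hadapted hmarkov mf f01 (m n) (r n).
rewrite {1}/m subnK// => D1.
have D2 : `|\sum_(0 <= j < r n) \int[Pr]_w
    kernel_dist (P (theta (m n + j)%N w)) (P (theta (m n) w)) - 0| < (e / 4)%:E.
  by near: n.
have H1 : `|\int[Pr]_w (excess (r n) (m n) w)%:E - 0| < (e / 4)%:E by near: n.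
have T2 : \int[Pr]_w tv_to_target P pi Xn theta (m n) (r n) w < (e / 4)%:E.
  by near: n.
rewrite !sube0 in D2 H1.
have D3 := le_lt_trans (lee_abs _) D2.
have H3 := le_lt_trans (lee_abs _) H1.
have G3 := mean_target_dist (mT n rn).
rewrite -(@subeK _ (\int[Pr]_w (f (Xn n w))%:E) _ Gfin) -(addeA (_ - _)).
apply: (le_lt_trans (lee_abs_add _ _)).
apply: (le_lt_trans (leeD D1 G3)).
apply: (lt_trans (lteD D3 (lteD H3 T2))).
by rewrite -!EFinD lte_fin; lra.
Unshelve. all: by end_near. Qed.

End convergence.

Theorem theorem2p1 (R : realType) (dX dT dO : measure_display)
  (X : measurableType dX) (Theta : measurableType dT)
  (Omega : measurableType dO) (Pr : probability Omega R)
  (F : nat -> set (set Omega)) (P : Theta -> R.-pker X ~> X)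
  (Xn : nat -> Omega -> X) (theta : nat -> Omega -> Theta)
  (pi : Theta -> probability X R)
  (hF : is_filtration F)
  (hP : forall A : set X, measurable A ->
    measurable_fun [set: Theta * X] (fun p : Theta * X => P p.1 p.2 A))
  (hadapted : forall n, measurable_fun [set: g_sigma_algebraType (F n)]
    (fun w : g_sigma_algebraType (F n) => (Xn n w, theta n w)))
  (hmarkov : forall g : X -> R, measurable_fun [set: X] g -> bounded_fun g ->
    forall n, is_cond_expectation Pr (F n)
      (fun w => (g (Xn n.+1 w))%:E)
      (fun w => \int[P (theta n w) (Xn n w)]_y (g y)%:E))
  (A1 : forall (t : Theta) (A : set X), measurable A ->
    \int[pi t]_x P t x A = pi t A)
  (A2 : forall eps : R, (0 < eps)%R -> exists r : nat -> nat,
    [/\ {homo r : m n / (m <= n)%N},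
        forall n, (0 < r n)%N,
        limn_esup (fun n => ((r n)%:R / n%:R : R)%:E) = 0,
        containment Pr P pi Xn theta eps r &
        diminishing_adaptation Pr P theta r])
  (f : X -> R) (hfm : measurable_fun [set: X] f) (hfb : bounded_fun f)
  (alpha : R)
  (hlim : {ae Pr, forall w,
    (fun n => \int[pi (theta n w)]_x (f x)%:E) @ \oo --> alpha%:E}) :
  (fun n => 'E_Pr[f \o Xn n]) @ \oo --> alpha%:E.

Proof.
have [c [b [c0 g01]]] := unit_rescaling hfb.
pose g x := (c * f x + b)%R.
have mg : measurable_fun [set: X] g.
  by apply: measurable_funD => //; exact: measurable_funM.
have gE n : \int[Pr]_w (g (Xn n w))%:E = c%:E * 'E_Pr[f \o Xn n] + b%:E.
  rewrite unlock; apply: (affine_integral (f := f \o Xn n)).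
  - exact: probability_setT.
  - exact: measurableT_comp (measurable_Xn hF hadapted n).
  - case: hfb => M [Mr fM]; exists M; split => // K MK w _ /=.
    exact: fM.
have fK n : 'E_Pr[f \o Xn n] =
    c^-1%:E * (\int[Pr]_w (g (Xn n w))%:E - b%:E).
  by rewrite gE addeK// muleA -EFinM mulVf// mul1e.
rewrite [X in X @ \oo --> _](funext fK).
have -> : alpha%:E = c^-1%:E * ((c * alpha + b)%:E - b%:E).
  by rewrite -EFinB -EFinM addrK mulKf.
apply: cvgeZl => //; apply: cvgeB => //; last exact: cvg_cst.
apply: (@unit_mean_cvg _ _ _ _ _ _ _ Pr F P Xn theta pi) => //.
- apply: filterS hlim => w piw.
  under eq_fun do rewrite (affine_integral _ _ (probability_setT _) hfm hfb).
  rewrite EFinD EFinM; apply: cvgeD => //; last exact: cvg_cst.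
  exact: cvgeZl.
- by move=> eps /A2[r [_ _ r0 cont dim]]; exists r.
Qed.
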